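(* Let $\mathcal{E}$ be a solvable $n$-dimensional evolution algebra with maximum index of solvability over a field of characteristic different from $2$. Then the following statements are equivalent: (i) $\mathcal{E}$ is supersolvable; (ii) there exists a natural basis $B$ of $\mathcal{E}$ such that the structure matrix $M_B(\mathcal{E})$ is block lower triangular, with each diagonal block being either the $1\times1$ block $0$ or the $2\times 2$ block $\begin{pmatrix}1&1\\-1&-1\end{pmatrix}$, and has rank $n-1$; (iii) the derived series of $\mathcal{E}$ does not have two consecutive terms that are not basic ideals.
   Context: An evolution algebra over a field $\mathbb{K}$ is a finite-dimensional $\mathbb{K}$-algebra $\mathcal{E}$ (bilinear product, not necessarily associative) admitting a basis $B=\{e_1,\dots,e_n\}$, called a natural basis, with $e_ie_j=0$ for $i\neq j$; writing $e_i^2=\sum_k a_{ik}e_k$, the structure matrix is $M_B(\mathcal{E})=(a_{ik})$. Put $\mathcal{E}^{(1)}=\mathcal{E}$, $\mathcal{E}^{(k+1)}=\mathcal{E}^{(k)}\mathcal{E}^{(k)}$ (span of products). $\mathcal{E}$ is solvable if $\mathcal{E}^{(k)}=0$ for some $k$, the least such $k$ being its index of solvability; the series $0=\mathcal{E}^{(k)}\subsetneq\mathcal{E}^{(k-1)}\subsetneq\dots\subsetneq\mathcal{E}^{(2)}\subsetneq\mathcal{E}$ is the derived series. An $n$-dimensional solvable evolution algebra has maximum index of solvability if the index is $n+1$ (the largest possible). An ideal $I$ of $\mathcal{E}$ is a basic ideal relative to a natural basis $B$ if $I$ is the span of a subset of $B$; ''basic ideal'' without mention of $B$ means basic relative to some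 natural basis. $\mathcal{E}$ is supersolvable if there is a chain $0=I_0\subsetneq I_1\subsetneq\dots\subsetneq I_n=\mathcal{E}$ of ideals of $\mathcal{E}$ with $\dim I_i=i$ for all $0\leq i\leq n$. *)

(* Defs.v *)
From HB Require Import structures.
From mathcomp Require Import all_boot all_order all_algebra.

Set Implicit Arguments.
Unset Strict Implicit.
Unset Printing Implicit Defensive.

Import GRing.Theory.

Local Open Scope ring_scope.

Section EvolutionAlgebra.

Variables (K : fieldType) (E : vectType K) (mul : {bilinear E -> E -> E}).

Implicit Types (U V W I : {vspace E}) (k n : nat).

(* Modelled on the library's [prodv], which requires a unital associative
   algebra; [mulsv_subP] says it is the span of all products. *)
Definition mulsv U V : {vspace E} :=
  <<[seq mul u v | u <- vbasis U, v <- vbasis V]>>%VS.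

Lemma mulsv_subP U V W :
  reflect (forall u v, u \in U -> v \in V -> mul u v \in W)
          (mulsv U V <= W)%VS.
Proof.
apply: (iffP idP) => [sUVW u v Uu Vv | sUVW].
  apply: (subvP sUVW).
  rewrite (coord_vbasis Uu) (coord_vbasis Vv) linear_sumlz.
  apply: rpred_sum => i _; rewrite linear_sumr; apply: rpred_sum => j _.
  rewrite linearZl_LR linearZr_LR; do 2!apply: rpredZ.
  by apply/memv_span/allpairs_f; apply: mem_nth; rewrite size_tuple.
apply/span_subvP => _ /allpairsP[[u v] /= [Uu Vv ->]].
by apply: sUVW; apply: vbasis_mem.
Qed.

Definition natural_basis n (B : n.-tuple E) : Prop :=
  basis_of {:E}%VS B /\
  forall i j : 'I_n, i != j -> mul (tnth B i) (tnth B j) = 0.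

Definition evolution_algebra : Prop :=
  exists B : (\dim {:E}).-tuple E, natural_basis B.

(* Row i holds the coordinates of e_i^2. *)
Definition structure_matrix n (B : n.-tuple E) : 'M[K]_n :=
  \matrix_(i, k) coord B k (mul (tnth B i) (tnth B i)).

(* E^(k), numbered from E^(1) = E; the value E^(0) = E is junk. *)
Definition derived_term k : {vspace E} :=
  iter k.-1 (fun U => mulsv U U) {:E}%VS.

Definition solvable_algebra : Prop :=
  exists2 k, (0 < k)%N & derived_term k = 0%VS.

Definition has_solvability_index k : Prop :=
  [/\ (0 < k)%N, derived_term k = 0%VS
    & forall j, (0 < j < k)%N -> derived_term j <> 0%VS].

Definition ideal I : Prop :=
  forall x y, x \in I -> mul x y \in I /\ mul y x \in I.

Definition basic_ideal I : Prop :=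
  ideal I /\
  exists B : (\dim {:E}).-tuple E, natural_basis B /\
  exists S : {set 'I_(\dim {:E})}, I = <<[seq tnth B i | i in S]>>%VS.

Definition supersolvable : Prop :=
  exists I : nat -> {vspace E},
  [/\ I 0%N = 0%VS, I (\dim {:E}) = {:E}%VS,
      forall i, (i < \dim {:E})%N -> (I i <= I i.+1)%VS /\ I i <> I i.+1
    & forall i, (i <= \dim {:E})%N -> ideal (I i) /\ \dim (I i) = i].

End EvolutionAlgebra.

(* For m = 1 and m = 2 the matrix with entries (-1)^a is respectively (1) and
   the 2 x 2 matrix with rows (1, 1) and (-1, -1). *)
Definition admissible_diag_block (K : fieldType) (m : nat) (D : 'M[K]_m) :
    Prop :=
  m = 1%N /\ D = 0 \/ m = 2%N /\ D = \matrix_(a < m, b < m) (-1) ^+ a.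

(* The cast along [n = \sum_i p i] only exhibits the block decomposition of A
   into blocks of sizes p i; it leaves the entries unchanged. *)
Definition admissible_block_lower_triangular (K : fieldType) (n : nat)
    (A : 'M[K]_n) : Prop :=
  exists (r : nat) (p : 'I_r -> nat) (np : n = (\sum_(i < r) p i)%N),
  let A' : 'M[K]_(\sum_(i < r) p i) := castmx (np, np) A in
  (forall i j : 'I_r, (i < j)%N -> submxblock A' i j = 0) /\
  (forall i : 'I_r, admissible_diag_block (submxblock A' i i)).

(* Main.v *)
(* Maximality of the index makes every term of the derived series have
   codimension one in the previous one. If I is an ideal not contained in
   E^(k+1) but contained in E^(k), then E^(k) = E^(k+1) + I, and squaring modulo
   I repeatedly gives E^(k) <= I: every ideal is a derived term. Hence E is
   supersolvable iff all derived terms are ideals.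

   For a natural basis B and an ideal I, the span V of the basis vectors
   occurring in I satisfies V V <= I <= V and is an ideal, so, by the previous
   point, of two consecutive derived terms that are ideals one is spanned by a
   part of B. Conversely V V is an ideal as soon as V V <= V and V is spanned by
   a part of B. This gives the equivalence with (iii), and it makes the dimension
   gaps between the derived terms spanned by a part of B equal to 1 or 2, which
   are the sizes of the diagonal blocks. *)
Require Import Defs.
From HB Require Import structures.
From mathcomp Require Import all_boot all_order all_algebra.
From mathcomp Require Import zify ring.

Set Implicit Arguments.
Unset Strict Implicit.
Unset Printing Implicit Defensive.

Import GRing.Theory VectorInternalTheory.

Local Open Scope ring_scope.

(** * Products of subspaces, natural bases and ideals *)

Section EvolutionAlgebraTheory.

Variables (K : fieldType) (E : vectType K) (mul : {bilinear E -> E -> E}).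

Implicit Types (U V W I : {vspace E}) (B S : seq E) (x y u v : E).

Lemma mul_span (X Y : seq E) W :
    {in X & Y, forall x y, mul x y \in W} ->
  {in <<X>>%VS & <<Y>>%VS, forall u v, mul u v \in W}.
Proof.
move=> XYW u v Xu Yv; rewrite (coord_span (X := in_tuple X) Xu).
rewrite linear_sumlz; apply: rpred_sum => i _.
rewrite linearZl_LR; apply: rpredZ.
rewrite (coord_span (X := in_tuple Y) Yv) linear_sumr.
apply: rpred_sum => j _; rewrite linearZr_LR; apply: rpredZ.
by apply: XYW; apply: mem_nth.
Qed.

Lemma mem_mulsv U V u v : u \in U -> v \in V -> mul u v \in mulsv mul U V.
Proof. exact: (mulsv_subP _ _ _ _ (subvv _)). Qed.

Lemma mulsvS U1 U2 V1 V2 :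
  (U1 <= U2 -> V1 <= V2 -> mulsv mul U1 V1 <= mulsv mul U2 V2)%VS.
Proof.
move=> sU sV; apply/mulsv_subP => u v uU vV.
by apply: mem_mulsv; [apply: subvP uU | apply: subvP vV].
Qed.

(** Squaring modulo an ideal: all products involving [I] are absorbed by [I]. *)
Lemma mulsv_addv_ideal U I :
  ideal mul I -> (mulsv mul (U + I) (U + I) <= mulsv mul U U + I)%VS.
Proof.
move=> idI; apply/mulsv_subP.
move=> _ _ /memv_addP[u Uu [i Ii ->]] /memv_addP[v Uv [j Ij ->]].
rewrite linearDl linearDr -addrA; apply: memv_add; first exact: mem_mulsv.
by apply: memvD; [apply: (idI _ _ Ij).2 | apply: (idI _ _ Ii).1].
Qed.

Lemma idealP U : reflect (ideal mul U)
  ((mulsv mul U {:E} <= U) && (mulsv mul {:E} U <= U))%VS.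
Proof.
apply: (iffP andP) => [[/mulsv_subP Ur /mulsv_subP Ul] x y Ux | idU].
  by split; [apply: Ur | apply: Ul]; rewrite ?memvf.
split; apply/mulsv_subP => x y; first by move=> /idU idx _; case: (idx y).
by move=> _ /idU idy; case: (idy x).
Qed.

(** Natural bases as plain lists, which can be filtered and concatenated. Comparing vectors instead
    of indices changes nothing, since a basis has no repeated vector. *)
Definition evolution_basis B : Prop :=
  basis_of {:E}%VS B /\ {in B &, forall x y, x != y -> mul x y = 0}.

Lemma natural_basisP n (B : n.-tuple E) :
  natural_basis mul B <-> evolution_basis B.
Proof.
split=> [] [basB B0]; split=> //.
  by move=> _ _ /tnthP[i ->] /tnthP[j ->] neq; apply: B0;
     apply: contraNneq neq => ->.
move=> i j neq.
apply: B0; rewrite ?mem_tnth ?(tnth_nth 0) // nth_uniq ?size_tuple //.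
exact: free_uniq (basis_free basB).
Qed.

(** A basis vector times a vector of [S] is either zero or the square of the latter, and [W] lies in
    the span of [S]; so only these squares matter. *)
Lemma ideal_of_squares B S W : evolution_basis B -> {subset S <= B} ->
  (W <= <<S>>)%VS -> {in S, forall x, mul x x \in W} -> ideal mul W.
Proof.
move=> [basB B0] sSB sWS sqS x y /(subvP sWS) Sx.
have By : y \in <<B>>%VS by rewrite (span_basis basB) memvf.
split.
  apply: (mul_span _ Sx By) => {x y Sx By} x y Sx By.
  by have [<-|neq] := eqVneq x y; [exact: sqS | rewrite B0 ?mem0v // sSB].
apply: (mul_span _ By Sx) => {x y Sx By} x y Bx Sy.
by have [->|neq] := eqVneq x y; [exact: sqS | rewrite B0 ?mem0v // sSB].
Qed.

(** The subset of [B] is taken as large as possible, so that no choice is involved, the predicate is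
    boolean, and the reverse inclusion is automatic. *)
Definition spanned_by B U := (U <= <<[seq x <- B | x \in U]>>)%VS.

Lemma spanned_byE B U : spanned_by B U -> <<[seq x <- B | x \in U]>>%VS = U.
Proof.
move=> sUB; apply/eqP; rewrite eqEsubv; apply/andP; split=> //.
by apply/span_subvP => x; rewrite mem_filter => /andP[].
Qed.

Lemma spanned_by_span B S : {subset S <= B} -> spanned_by B <<S>>%VS.
Proof.
move=> sSB; apply: sub_span => x Sx.
by rewrite mem_filter sSB // andbT memv_span.
Qed.

Lemma spanned_byD B U V :
  spanned_by B U -> spanned_by B V -> spanned_by B (U + V).
Proof.
move=> /spanned_byE <- /spanned_byE <-; rewrite -span_cat.
by apply: spanned_by_span => x; rewrite mem_cat !mem_filter => /orP[]/andP[].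
Qed.

Lemma spanned_by_fresh B U V : spanned_by B V -> ~~ (V <= U)%VS ->
  exists x, [/\ x \in B, x \in V & x \notin U].
Proof.
move=> /spanned_byE defV; rewrite -{1}defV => nVU.
have /allPn[x] : ~~ all (fun x => x \in U) [seq x <- B | x \in V].
  by apply: contraNN nVU => /allP sVU; apply/span_subvP.
by rewrite mem_filter => /andP[Vx Bx] nUx; exists x.
Qed.

Lemma basic_idealP U : basic_ideal mul U <->
  ideal mul U /\ exists2 B, evolution_basis B & spanned_by B U.
Proof.
split=> [] [idU]; last first.
  case=> B evoB /spanned_byE defU; split=> //.
  have sB : size B == \dim {:E}.
    by rewrite (@size_basis _ _ _ _ (in_tuple B)) //; case: evoB.
  exists (Tuple sB); split; first by apply/natural_basisP.
  exists [set i | tnth (Tuple sB) i \in U].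
  rewrite -[LHS]defU; apply: eq_span => x; rewrite mem_filter.
  apply/andP/mapP => [[Ux Bx] | [i]].
    have /tnthP[i defx] : x \in Tuple sB by [].
    by exists i; rewrite // mem_enum inE -defx.
  rewrite mem_enum inE => Ui ->; split=> //.
  exact: (mem_tnth i (Tuple sB)).
case=> B [/natural_basisP evoB [S defU]]; split=> //; exists B => //.
by rewrite defU; apply: spanned_by_span => _ /mapP[i _ ->]; apply: mem_tnth.
Qed.

Lemma ideal_mulsv_spanned B U : evolution_basis B -> spanned_by B U ->
  (mulsv mul U U <= U)%VS -> ideal mul (mulsv mul U U).
Proof.
move=> evoB /spanned_byE defU sUU.
apply: (ideal_of_squares (S := [seq x <- B | x \in U]) evoB).
- by move=> x; rewrite mem_filter => /andP[].
- by rewrite defU.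
- by move=> x; rewrite mem_filter => /andP[Ux _]; apply: mem_mulsv.
Qed.

(** If the basis vector e_i occurs in some w of [W], then w e_i is a nonzero multiple of e_i^2, so
    e_i^2 lies in [W]. The witness [V] is the span of all such e_i. *)
Lemma ideal_support B W : evolution_basis B -> ideal mul W ->
  exists V, [/\ spanned_by B V, ideal mul V, (W <= V)%VS
              & (mulsv mul V V <= W)%VS].
Proof.
move=> evoB idW; have [basB B0] := evoB; pose X := in_tuple B.
pose P i := [exists j, coord X i (vbasis W)`_(nat_of_ord (j : 'I_(\dim W))) != 0].
pose S := [seq X`_i | i : 'I_(size B) in P].
have sSB : {subset S <= B} by move=> _ /mapP[i _ ->]; apply: mem_nth.
have sWS : (W <= <<S>>)%VS.
  rewrite -(span_basis (vbasisP W)); apply/span_subvP => x /(nthP 0)[j].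
  rewrite size_tuple => ltj <-; set w := _`_j.
  rewrite (coord_basis (X := X) basB (memvf w)); apply: rpred_sum => i _.
  have [-> | wi] := eqVneq (coord X i w) 0; first by rewrite scale0r mem0v.
  apply/rpredZ/memv_span/map_f; rewrite mem_enum unfold_in.
  by apply/existsP; exists (Ordinal ltj).
have sqS : {in S, forall x, mul x x \in W}.
  move=> _ /mapP[i + ->]; rewrite mem_enum => /existsP[j].
  set w := _`_j => wi.
  have Ww : w \in W by apply/vbasis_mem/mem_nth; rewrite size_tuple.
  have mul0 k : k != i -> mul X`_k X`_i = 0.
    move=> neq; apply: B0; rewrite ?mem_nth //.
    by rewrite nth_uniq // (free_uniq (basis_free basB)).
  have := (idW w X`_i Ww).1.
  rewrite {1}(coord_basis (X := X) basB (memvf w)) linear_sumlz.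
  rewrite (bigD1 i) //= big1 => [|k /mul0 ki0]; last first.
    by rewrite linearZl_LR /= ki0 scaler0.
  by rewrite addr0 linearZl_LR /= rpredZeq (negPf wi).
exists <<S>>%VS; split=> //.
- exact: spanned_by_span.
- apply: (ideal_of_squares evoB sSB) => // x Sx.
  by apply: (subvP sWS); apply: sqS.
- apply/mulsv_subP; apply: mul_span => x y Sx Sy.
  have [->|neq] := eqVneq x y; first exact: sqS.
  by rewrite B0 ?mem0v // sSB.
Qed.

End EvolutionAlgebraTheory.

(** * Ideals when each derived term has codimension one in the previous one *)

Section MaximalIndex.

Variables (K : fieldType) (E : vectType K) (mul : {bilinear E -> E -> E}).
Variables (n : nat) (J : nat -> {vspace E}).

(* [J m] is the derived term of dimension [m]. *)
Hypothesis JnT : J n = {:E}%VS.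
Hypothesis dimJ : forall m, (m <= n)%N -> \dim (J m) = m.
Hypothesis sqJ : forall m, (m < n)%N -> mulsv mul (J m.+1) (J m.+1) = J m.

(** Squaring is monotone, so inclusions propagate downwards from [J n], the whole space; hence the
    induction on [n - m]. *)
Lemma derived_step m : (m < n)%N -> (J m <= J m.+1)%VS.
Proof.
have [k] := ubnP (n - m); elim: k m => // k IHk m ltk ltmn.
have [eqmn | neq] := eqVneq m.+1 n; first by rewrite eqmn JnT subvf.
have ltmn1 : (m.+1 < n)%N by rewrite ltn_neqAle neq.
have sJ : (J m.+1 <= J m.+2)%VS by apply: IHk; lia.
by rewrite -(sqJ ltmn) -[X in (_ <= X)%VS](sqJ ltmn1) mulsvS.
Qed.

Lemma ideal_derived (I : {vspace E}) : ideal mul I -> I = J (\dim I).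
Proof.
move=> idI; set d := \dim I.
have ledn : (d <= n)%N by rewrite -(dimJ (leqnn n)) JnT dimvS ?subvf.
(* Squaring the first inclusion modulo [I] gives [J j <= J i + I], which is then substituted into
   the second. *)
have lift i j : (i.+1 <= j < n)%N -> (J j.+1 <= J i.+1 + I)%VS ->
    (J j.+1 <= J j + I)%VS -> (J j.+1 <= J i + I)%VS.
  move=> /andP[leij ltjn] sJi sJj; apply: subv_trans sJj _.
  rewrite subv_add addvSr andbT -{1}(sqJ ltjn).
  rewrite (subv_trans (mulsvS mul sJi sJi)) //.
  by rewrite -(sqJ (leq_trans leij (ltnW ltjn))) mulsv_addv_ideal.
(* [I] is pushed down the derived series one term at a time, as long as the dimension of the term is
   at least [d]. *)
have sub t : (d + t <= n)%N -> (I <= J (n - t))%VS.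
  elim: t => [|t IHt] ledt; first by rewrite subn0 JnT subvf.
  have {IHt} : (I <= J (n - t))%VS by apply: IHt; lia.
  have -> : (n - t = (n - t.+1).+1)%N by lia.
  have ltjn : (n - t.+1 < n)%N by lia.
  have ledj : (d <= n - t.+1)%N by lia.
  move: (n - t.+1)%N ltjn ledj => j ltjn ledj sIJ.
  have [//|nsIJ] := boolP (I <= J j)%VS.
  (* [J j + I] lies strictly above [J j] and inside [J j.+1], which is only one dimension larger. *)
  have sJj : (J j.+1 <= J j + I)%VS.
    have sU : (J j + I <= J j.+1)%VS by rewrite subv_add derived_step.
    rewrite -(geq_leqif (dimv_leqif_sup sU)) dimJ // -{1}(dimJ (ltnW ltjn)).
    by rewrite (ltn_leqif (dimv_leqif_sup (addvSl _ _))) subv_add subvv.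
  have sJ k : (k <= j)%N -> (J j.+1 <= J (j - k) + I)%VS.
    elim: k => [|k IHk] lek; first by rewrite subn0.
    apply: lift => //; first lia.
    have -> : ((j - k.+1).+1 = j - k)%N by lia.
    by apply: IHk; lia.
  (* At [k = j] the space [J j.+1], of dimension [j.+1], falls inside [I], whose dimension is at
     most [j]: a contradiction. *)
  have := dimvS (sJ j (leqnn j)).
  have /eqP -> : J (j - j)%N == 0%VS by rewrite subnn -dimv_eq0 dimJ.
  by rewrite add0v dimJ // -/d; lia.
apply/eqP; rewrite eqEdim -/d dimJ // leqnn andbT.
by have := sub (n - d)%N; rewrite subKn //; apply; lia.
Qed.

Lemma supersolvable_derived :
  supersolvable mul <-> forall m, (m <= n)%N -> ideal mul (J m).
Proof.
have dimE : \dim {:E} = n by rewrite -JnT dimJ.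
rewrite /supersolvable dimE; split=> [[I [_ _ _ idI]] m lemn | idJ].
  by have [idIm dimIm] := idI m lemn; rewrite -dimIm -ideal_derived.
exists J; split=> // [|i ltin | i lein].
- by apply/eqP; rewrite -dimv_eq0 dimJ.
- split; first exact: derived_step.
  by move=> /(congr1 (fun U => \dim U)); rewrite !dimJ // 1?ltnW //; lia.
- by split; [apply: idJ | apply: dimJ].
Qed.

(** The support [V] of [J m] is an ideal, hence [J d] with [m <= d]. For [d > 0] its square [J d.-1]
    lies in [J m], so [d] is [m] or [m.+1]. *)
Lemma spanned_derived B m : evolution_basis mul B -> ideal mul (J m) ->
  (m < n)%N -> spanned_by B (J m) \/ spanned_by B (J m.+1).
Proof.
move=> evoB idJ ltmn.
have [V [spV idV sJV sVJ]] := ideal_support evoB idJ.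
have leVn : (\dim V <= n)%N by rewrite -(dimJ (leqnn n)) JnT dimvS ?subvf.
have defV := ideal_derived idV.
have := dimvS sJV; rewrite dimJ ?(ltnW ltmn) // => lemV.
have leVm : (\dim V <= m.+1)%N.
  move: defV leVn; case: (\dim V) => // d defV ltdn.
  by move: sVJ; rewrite defV sqJ // => /dimvS; rewrite !dimJ //; lia.
have [eqVm | neVm] := eqVneq (\dim V) m; first by left; rewrite -eqVm -defV.
have eqVm : \dim V = m.+1 by lia.
by right; rewrite -eqVm -defV.
Qed.

(* Negated, since [basic_ideal] is not decidable; [ideal] is, by [idealP]. *)
Lemma supersolvable_basic : evolution_algebra mul ->
  supersolvable mul <->
  forall m, (m < n)%N ->
    ~ (~ basic_ideal mul (J m.+1) /\ ~ basic_ideal mul (J m)).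
Proof.
case=> B /natural_basisP evoB; apply: (iff_trans supersolvable_derived).
split=> [idJ m ltmn [nbJ1 nbJ] | basJ m].
  have [spJ | spJ] := spanned_derived evoB (idJ m (ltnW ltmn)) ltmn.
    by apply/nbJ/basic_idealP; split; [apply/idJ/ltnW | exists B].
  by apply/nbJ1/basic_idealP; split; [apply: idJ | exists B].
rewrite leq_eqVlt => /predU1P[-> | ltmn].
  by rewrite JnT => x y _; rewrite !memvf.
apply/idealP/negPn/negP => nidJ; apply: (basJ m ltmn); split; last first.
  by move=> /basic_idealP[/idealP idJ _]; rewrite idJ in nidJ.
move=> /basic_idealP[_ [B1 evoB1 spJ]]; case/idealP: nidJ.
rewrite -(sqJ ltmn); apply: ideal_mulsv_spanned evoB1 spJ _.
by rewrite sqJ ?derived_step.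
Qed.

End MaximalIndex.

(** * Dimensions of the derived terms *)

Lemma derived_termS (K : fieldType) (E : vectType K)
    (mul : {bilinear E -> E -> E}) k :
  (0 < k)%N ->
  derived_term mul k.+1 = mulsv mul (derived_term mul k) (derived_term mul k).
Proof. by case: k. Qed.

(** Two equal consecutive terms would make the series constant from there on, hence zero too early.
    So the [n] steps from dimension [n] to 0 are all strict, and each drops the dimension by exactly
    one. *)
Lemma dim_derived_term (K : fieldType) (E : vectType K)
    (mul : {bilinear E -> E -> E}) n m :
  \dim {:E} = n -> has_solvability_index mul n.+1 -> (m <= n)%N ->
  \dim (derived_term mul (n.+1 - m)) = m.
Proof.
move=> dimE [_ D0 Dn0].
have subD k : (0 < k)%N -> (derived_term mul k.+1 <= derived_term mul k)%VS.
  elim: k => // -[_ _|k IHk _]; first exact: subvf.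
  by rewrite derived_termS // [X in (_ <= X)%VS]derived_termS // mulsvS ?IHk.
have ltD k : (0 < k <= n)%N ->
    (\dim (derived_term mul k.+1) < \dim (derived_term mul k))%N.
  case/andP=> k0 lekn; rewrite (ltn_leqif (dimv_leqif_sup (subD k k0))).
  apply/negP => sD; have /(Dn0 k)[] : (0 < k < n.+1)%N by rewrite k0.
  have eqD : derived_term mul k.+1 = derived_term mul k.
    by apply/eqP; rewrite eqEsubv subD.
  rewrite -D0; have : (k <= n.+1)%N by apply: leqW.
  elim: (n.+1) => [|j IHj]; first by rewrite leqn0 => /eqP k00; rewrite k00 in k0.
  rewrite leq_eqVlt => /predU1P[-> // | ]; rewrite ltnS => lekj.
  by rewrite derived_termS ?(leq_trans k0) // -IHj // -derived_termS.
have upper k : (k <= n)%N -> (\dim (derived_term mul k.+1) <= n - k)%N.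
  elim: k => [|k IHk] lek; first by rewrite dimE subn0.
  by have := ltD k.+1; rewrite lek => /(_ isT); have := IHk (ltnW lek); lia.
move=> lemn; apply/eqP; rewrite eqn_leq; apply/andP; split.
  by have := upper (n - m)%N; rewrite subSn // subKn //; apply; lia.
elim: m lemn => // m IHm ltmn.
have -> : (n.+1 - m.+1 = n - m)%N by lia.
have := ltD (n - m)%N; rewrite -subSn ?(ltnW ltmn) // => /(_ _).
by have := IHm (ltnW ltmn); lia.
Qed.

(** * Diagonal blocks as lists of basis vectors, and the ideals they produce *)

Section Blocks.

Variables (K : fieldType) (E : vectType K) (mul : {bilinear E -> E -> E}).

Implicit Types (U V W : {vspace E}) (b B : seq E) (bs : seq (seq E)).

(** A coordinate-free form of the rows through a diagonal block, with [U] the span of the earlier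
    blocks: working modulo [U] leaves the entries left of the block free and makes those to its
    right vanish. *)
Definition admissible_block U b : Prop :=
  size b = 1%N /\ mul b`_0 b`_0 \in U \/
  size b = 2%N /\ forall a, (a < 2)%N ->
    mul b`_a b`_a - (-1) ^+ a *: (\sum_(y <- b) y) \in U.

Definition admissible_blocks bs : Prop :=
  forall i, (i < size bs)%N ->
    admissible_block <<flatten (take i bs)>> (nth [::] bs i).

Lemma admissible_blocks_rcons bs b :
  admissible_blocks (rcons bs b) <->
  admissible_blocks bs /\ admissible_block <<flatten bs>> b.
Proof.
split=> [adm | [adm admb] i].
  split=> [i lti|]; last first.
    by have := adm (size bs); rewrite size_rcons -cats1 take_size_cat // cats1
      nth_rcons ltnn eqxx; apply.
  have := adm i; rewrite size_rcons ltnS (ltnW lti) nth_rcons lti.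
  by rewrite -cats1 takel_cat ?(ltnW lti) //; apply.
rewrite size_rcons ltnS leq_eqVlt nth_rcons => /predU1P[-> | lti].
  by rewrite ltnn eqxx -cats1 take_size_cat.
by rewrite lti -cats1 takel_cat ?(ltnW lti) //; apply: adm.
Qed.

Lemma admissible_block1 U x : admissible_block U [:: x] <-> mul x x \in U.
Proof. by split=> [[[_ //] | []] | Uxx] //; left. Qed.

Lemma admissible_block2 U x y : admissible_block U [:: x; y] <->
  mul x x - (x + y) \in U /\ mul y y + (x + y) \in U.
Proof.
rewrite /admissible_block big_cons big_seq1; split=> [[[] //|[_ adm]] | [Ux Uy]].
  have := adm 0%N isT; have := adm 1%N isT.
  by rewrite /= expr0 expr1 scale1r scaleN1r opprK.
right; split=> // -[|[|//]] _ /=; first by rewrite expr0 scale1r.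
by rewrite expr1 scaleN1r opprK.
Qed.

Lemma admissible_block_inv U b : admissible_block U b ->
  (exists2 x, b = [:: x] & mul x x \in U) \/
  exists x y, [/\ b = [:: x; y], mul x x - (x + y) \in U
                & mul y y + (x + y) \in U].
Proof.
case: b => [|x [|y []]] => [| /admissible_block1 | /admissible_block2[] |].
- by case=> [] [].
- by left; exists x.
- by right; exists x, y.
- by move=> ? ? [] [].
Qed.

Lemma admissible_block_square U b x : admissible_block U b -> x \in b ->
  mul x x \in (U + <<b>>)%VS.
Proof.
case/admissible_block_inv=> [[y -> Uy] | [y [z [-> Uy Uz]]]].
  by rewrite inE => /eqP->; apply: subvP (addvSl _ _) _ Uy.
set S := <<_>>%VS; have Syz : y + z \in S.
  by apply: memvD; apply: memv_span; rewrite !inE eqxx ?orbT.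
rewrite !inE => /orP[] /eqP ->.
  by rewrite -[mul y y](subrK (y + z)) memv_add.
by rewrite -[mul z z](addrK (y + z)) memv_add ?memvN.
Qed.

Lemma admissible_blocks_square bs x : admissible_blocks bs ->
  x \in flatten bs -> mul x x \in <<flatten bs>>%VS.
Proof.
elim/last_ind: bs => // bs b IHbs /admissible_blocks_rcons[adm admb].
rewrite flatten_rcons mem_cat span_cat => /orP[Bx | bx].
  by apply: subvP (addvSl _ _) _ (IHbs adm Bx).
exact: admissible_block_square.
Qed.

(** The span of the first blocks is an ideal. Inside a block [[:: x; y]] the missing dimension comes
    from adding the line of [x + y], since modulo the earlier blocks the squares of [x] and [y] are
    [x + y] and its opposite. The tail [B] keeps the whole basis at hand while the induction removes
    the last block. *)
Lemma admissible_blocks_ideal bs B m :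
    evolution_basis mul (flatten bs ++ B) -> admissible_blocks bs ->
  (m <= size (flatten bs))%N -> exists2 I, ideal mul I & \dim I = m.
Proof.
elim/last_ind: bs B => [|bs b IHbs] B.
  move=> _ _; rewrite leqn0 => /eqP ->; exists 0%VS; last exact: dimv0.
  by move=> x y; rewrite memv0 => /eqP->; rewrite linear0l linear0r mem0v.
rewrite flatten_rcons -catA => evoB /admissible_blocks_rcons[adm admb].
have [lem _ | ltm] := leqP m (size (flatten bs)); first exact: IHbs evoB adm lem.
rewrite size_cat => lem.
have freeB : free (flatten bs ++ b).
  by have /basis_free := evoB.1; rewrite catA; apply: catl_free.
have sbB : {subset flatten bs ++ b <= flatten bs ++ b ++ B}.
  by move=> x; rewrite !mem_cat => /orP[] ->; rewrite ?orbT.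
have sq x : x \in flatten bs -> mul x x \in <<flatten bs>>%VS.
  exact: admissible_blocks_square.
have [eqm | neqm] := eqVneq m (size (flatten bs) + size b)%N.
  exists <<flatten bs ++ b>>%VS; last first.
    by rewrite eqm -size_cat; apply/eqP.
  apply: (ideal_of_squares evoB sbB) => // x.
  rewrite -flatten_rcons; apply: admissible_blocks_square.
  exact/admissible_blocks_rcons.
case/admissible_block_inv: admb => [[x defb _] | [x [y [defb Ux Uy]]]]; subst b.
  by move: lem neqm => /=; lia.
rewrite /= in lem neqm.
have -> : m = (size (flatten bs)).+1 by lia.
have nUxy : x + y \notin <<flatten bs>>%VS.
  apply/negP => Uxy; have : free (x :: flatten bs ++ [:: y]).
    move: freeB.
    by rewrite -(perm_free (_ : perm_eq (x :: flatten bs ++ [:: y]) _)) //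
      perm_sym -cat1s perm_catCA.
  rewrite free_cons => /andP[/negP[]]; rewrite -[x](addrK y) span_cat.
  by apply: memvB; [apply: subvP (addvSl _ _) _ Uxy|
     apply: subvP (addvSr _ _) _ (memv_span1 y)].
exists <<flatten bs ++ [:: (x + y)%R]>>%VS.
  apply: (ideal_of_squares evoB sbB) => [|z].
    apply/span_subvP => z; rewrite mem_cat inE => /orP[Bz | /eqP ->].
      by rewrite memv_span // mem_cat Bz.
    by apply: memvD; apply: memv_span; rewrite mem_cat !inE eqxx ?orbT.
  rewrite span_cat span_seq1 mem_cat !inE => /or3P[Bz | /eqP -> | /eqP ->].
  - by apply: subvP (addvSl _ _) _ (sq _ Bz).
  - by rewrite -[mul x x](subrK (x + y)) memv_add ?memv_line.
  - by rewrite -[mul y y](addrK (x + y)) memv_add ?memvN ?memv_line.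
apply/eqP; rewrite -addn1 -[1%N]/(size [:: x + y]) -size_cat -/(free _).
rewrite (perm_free (_ : perm_eq _ ((x + y) :: flatten bs))).
  by rewrite free_cons nUxy (catl_free freeB).
by rewrite cats1 perm_rcons.
Qed.

Lemma mul_fresh B U x u : evolution_basis mul B -> spanned_by B U ->
  x \in B -> x \notin U -> u \in U -> mul u x = 0 /\ mul x u = 0.
Proof.
move=> [_ B0] /spanned_byE <- Bx nUx Uu.
have neq y : y \in [seq z <- B | z \in U] -> y \in B /\ y != x.
  by rewrite mem_filter => /andP[Uy By]; split=> //; apply: contraNneq nUx => <-;
     rewrite memv_span // mem_filter Uy.
have x0 : x \in <<[:: x]>>%VS by apply: memv_span1.
split; apply/eqP; rewrite -memv0.
  apply: (mul_span _ Uu x0) => y z /neq[By nyx] /[!inE] /eqP->.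
  by rewrite B0 ?mem0v.
apply: (mul_span _ x0 Uu) => z y /[!inE] /eqP-> /neq[By nyx].
by rewrite B0 ?mem0v // eq_sym.
Qed.

Lemma dim_add_line U x : x \notin U -> \dim (U + <[x]>) = (\dim U).+1.
Proof.
move=> nUx; have x0 : x != 0 by apply: contraNneq nUx => ->; rewrite mem0v.
rewrite dimv_disjoint_sum ?dim_vline ?x0 ?addn1 //.
apply/eqP; rewrite -subv0; apply/subvP => v /memv_capP[Uv /vlineP[k defv]].
rewrite memv0; have [k0 | k0] := eqVneq k 0; first by rewrite defv k0 scale0r.
by case/negP: nUx; rewrite -[x](scalerK k0) -defv rpredZ.
Qed.

Lemma add_line_eq U V x : (U <= V)%VS -> \dim V = (\dim U).+1 ->
  x \in V -> x \notin U -> (U + <[x]>)%VS = V.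
Proof.
move=> sUV dimV Vx nUx; apply/eqP; rewrite eqEdim dim_add_line // dimV leqnn.
by rewrite subv_add sUV -memvE Vx.
Qed.

End Blocks.

(** * Normal form of a block of size two *)

Section BlockConstruction.

Variables (K : fieldType) (E : vectType K) (mul : {bilinear E -> E -> E}).

Implicit Types (x y : E).

Lemma vlineZ k x : k != 0 -> <[k *: x]>%VS = <[x]>%VS.
Proof.
move=> k0; apply/eqP; rewrite eqEsubv -!memvE memvZ ?memv_line //=.
by rewrite -{1}[x](scalerK k0) memvZ ?memv_line.
Qed.

(* With [W] spanned over [U] by [v = a b1 + b b2] and
   [b1^2 = c v, b2^2 = d v] modulo [U], the inclusion [W W <= U] reads
   [a^2 c + b^2 d = 0]; as [W] is not spanned by basis vectors, none of these
   scalars vanishes, and [b1, b2] can be rescaled to the normal form. *)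
Lemma admissible_block_exists B (U W V : {vspace E}) :
    evolution_basis mul B -> ideal mul U -> (U <= W <= V)%VS ->
    \dim W = (\dim U).+1 -> \dim V = (\dim U).+2 ->
    mulsv mul V V = W -> (mulsv mul W W <= U)%VS ->
    spanned_by B U -> ~ spanned_by B W -> spanned_by B V ->
  exists x y, [/\ (U + <<[:: x; y]>>)%VS = V, admissible_block mul U [:: x; y],
                  mul x y = 0, mul y x = 0
                & {in U, forall u, [/\ mul u x = 0, mul x u = 0,
                                      mul u y = 0 & mul y u = 0]}].
Proof.
move=> evoB idU /andP[sUW sWV] dimW dimV sqV sqW spU nspW spV.
have [x [Bx Vx nUx]] : exists x, [/\ x \in B, x \in V & x \notin U].
  by apply: spanned_by_fresh spV _; apply/negP => /dimvS; rewrite dimV; lia.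
have [y [By Vy nUxy]] : exists y, [/\ y \in B, y \in V & y \notin (U + <[x]>)%VS].
  apply: spanned_by_fresh spV _; apply/negP => /dimvS.
  by rewrite dimV dim_add_line // ltnn.
have nUy : y \notin U by apply: contraNN nUxy; apply: subvP (addvSl _ _) y.
have neqxy : x != y.
  apply: contraNneq nUxy => <-; apply: subvP (addvSr _ _) _ (memv_line x).
have xy0 : mul x y = 0 by apply: evoB.2.
have yx0 : mul y x = 0 by apply: evoB.2; rewrite // eq_sym.
have defV : (U + <[x]> + <[y]>)%VS = V.
  apply: add_line_eq => //; first by rewrite subv_add (subv_trans sUW sWV) -memvE.
  by rewrite dim_add_line.
(* Such a [z] in [W] would give [W = U + <[z]>], spanned by [B]. Applied to [x] and [y], this makes
   both coefficients of [v] below nonzero. *)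
have nW z : z \in B -> z \notin U -> z \notin W.
  move=> Bz nUz; apply/negP => Wz; apply: nspW.
  rewrite -(add_line_eq sUW dimW Wz nUz); apply: spanned_byD => //.
  by rewrite -span_seq1; apply: spanned_by_span => _ /[!inE] /eqP ->.
have [v Wv [nUv [a [b defv]]]] : exists2 v, v \in W & v \notin U /\
    exists a b, v = a *: x + b *: y.
  have /subvPn[v Wv nUv] : ~~ (W <= U)%VS.
    by apply/negP => /dimvS; rewrite dimW ltnn.
  have := subvP sWV _ Wv; rewrite -defV -addvA => /memv_addP[u Uu [w]].
  case/memv_addP=> _ /vlineP[a ->] [_ /vlineP[b ->] ->] defv.
  exists (v - u); first by rewrite rpredB // (subvP sUW).
  split; last by exists a, b; rewrite defv addrC addKr.
  by apply: contraNN nUv => /(rpredD Uu); rewrite addrC subrK.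
have a0 : a != 0.
  apply: contraNneq (nW y By nUy) => a0; move: defv nUv.
  rewrite a0 scale0r add0r => defv; have [b0 | b0] := eqVneq b 0.
    by rewrite defv b0 scale0r mem0v.
  by rewrite -[y](scalerK b0) -defv rpredZ.
have b0 : b != 0.
  apply: contraNneq (nW x Bx nUx) => b0; move: defv nUv.
  rewrite b0 scale0r addr0 => defv _.
  by rewrite -[x](scalerK a0) -defv rpredZ.
have sqW' z : z \in V -> exists c, mul z z - c *: v \in U.
  move=> Vz; have : mul z z \in W by rewrite -sqV; apply: mem_mulsv.
  rewrite -(add_line_eq sUW dimW Wv nUv).
  case/memv_addP=> u Uu [_ /vlineP[c ->] ->].
  by exists c; rewrite addrK.
have [c Uc] := sqW' x Vx; have [d Ud] := sqW' y Vy.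
have eqcd : a ^+ 2 * c + b ^+ 2 * d = 0.
  have Uvv : mul v v \in U by apply: (subvP sqW); apply: mem_mulsv.
  apply: contraNeq nUv => cd0.
  rewrite -[v](scalerK cd0); apply: rpredZ.
  have vv : mul v v = a ^+ 2 *: mul x x + b ^+ 2 *: mul y y.
    rewrite defv linearDl !linearDr !linearZl_LR !linearZr_LR /=.
    by rewrite xy0 yx0 !scaler0 addr0 add0r !scalerA -!expr2.
  have -> : (a ^+ 2 * c + b ^+ 2 * d) *: v = mul v v
      - (a ^+ 2 *: (mul x x - c *: v) + b ^+ 2 *: (mul y y - d *: v)).
    rewrite vv !scalerBr !scalerA scalerDl opprD !opprB addrACA.
    by rewrite (addrCA (_ *: mul x x)) (addrCA (_ *: mul y y)) !subrr !addr0.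
  by rewrite rpredB // rpredD // rpredZ.
(* If [c = 0], then [eqcd] forces [d = 0]; both squares lie in [U], and so does the square of [V],
   which is [W]. *)
have c0 : c != 0.
  apply/eqP => c0; move: Uc Ud eqcd.
  rewrite c0 mulr0 scale0r subr0 add0r => Ux + /eqP.
  rewrite mulf_eq0 expf_eq0 /= (negPf b0) /= => + /eqP d0.
  rewrite d0 scale0r subr0 => Uy.
  suff : (W <= U)%VS by move/dimvS; rewrite dimW ltnn.
  rewrite -sqV -defV -addvA addvC.
  apply: subv_trans (mulsv_addv_ideal _ idU) _.
  rewrite subv_add subvv andbT -!span_seq1 -span_cat /=.
  apply/mulsv_subP; apply: mul_span => _ _ /[!inE] /orP[] /eqP -> /orP[] /eqP -> //.
    by rewrite xy0 mem0v.
  by rewrite yx0 mem0v.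
(* Modulo [U], the square of [p *: x] is [p ^+ 2 * c] times [v]. Equating it with [p *: x + q *: y]
   gives [p = p ^+ 2 * c * a] and [q = p ^+ 2 * c * b]. The condition on [q *: y] then follows from
   [eqcd]. *)
pose p := (c * a)^-1; pose q := b / (c * a ^+ 2).
have p0 : p != 0 by rewrite invr_eq0 mulf_neq0.
have q0 : q != 0 by rewrite mulf_neq0 // invr_eq0 mulf_neq0 // expf_neq0.
exists (p *: x), (q *: y); split.
- rewrite span_cons span_seq1 -defV -!addvA; by rewrite !vlineZ.
- have defd : d = - (a ^+ 2 * c) / b ^+ 2.
    apply/eqP; rewrite -(inj_eq (mulfI (expf_neq0 2 b0))) mulrCA.
    by rewrite mulfV ?expf_neq0 // mulr1 -addr_eq0 addrC eqcd.
  apply/admissible_block2; split.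
    have -> : mul (p *: x) (p *: x) - (p *: x + q *: y) =
              p ^+ 2 *: (mul x x - c *: v).
      rewrite linearZl_LR linearZr_LR /= scalerBr !scalerA -expr2 defv.
      rewrite scalerDr !scalerA.
      by congr (_ - (_ *: _ + _ *: _)); rewrite /p /q; field; rewrite ?a0 ?c0.
    exact: rpredZ.
  have -> : mul (q *: y) (q *: y) + (p *: x + q *: y) =
            q ^+ 2 *: (mul y y - d *: v).
    rewrite linearZl_LR linearZr_LR /= scalerBr !scalerA -expr2 defv.
    rewrite scalerDr !scalerA opprD -!scaleNr.
    congr (_ + (_ *: _ + _ *: _)); rewrite /p /q defd; field;
      by rewrite ?a0 ?b0 ?c0.
  exact: rpredZ.
- by rewrite linearZl_LR linearZr_LR /= xy0 !scaler0.
- by rewrite linearZl_LR linearZr_LR /= yx0 !scaler0.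
move=> u Uu; have [ux xu] := mul_fresh evoB spU Bx nUx Uu.
have [uy yu] := mul_fresh evoB spU By nUy Uu.
by split; rewrite ?linearZl_LR ?linearZr_LR /= ?ux ?xu ?uy ?yu scaler0.
Qed.

End BlockConstruction.

(** Right multiplication by [b2mx B], whose rows are free, turns the coordinate matrix into [b2mx X]
    and keeps the rank. *)
Lemma rank_coord_mx (K : fieldType) (E : vectType K) m n (B : n.-tuple E)
    (X : m.-tuple E) :
  basis_of {:E}%VS B ->
  \rank (\matrix_(i < m, k < n) coord B k (tnth X i)) = \dim <<X>>.
Proof.
move=> basB.
have dim_b2mx k (Y : k.-tuple E) :
    \dim <<Y>> = \rank (b2mx Y).
  (* The span is defined from [in_tuple Y], a cast of [Y]; the cast disappears by elimination of its
     equality. *)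
  rewrite -(genmxE (b2mx Y)) unlock tvalK.
  by case: _ / (esym _).
rewrite dim_b2mx -(@mxrankMfree _ _ _ _ _ (b2mx B)).
  congr (\rank _); apply/row_matrixP => i; rewrite row_mul mulmx_sum_row rowK.
  rewrite [in RHS](coord_basis basB (memvf (tnth X i))).
  rewrite linear_sum.
  by apply: eq_bigr => j _; rewrite !mxE rowK linearZ -tnth_nth.
by rewrite /row_free -dim_b2mx (span_basis basB) (size_basis basB).
Qed.

(** * Supersolvability and admissible blocks *)

Section MaximalIndexBlocks.

Variables (K : fieldType) (E : vectType K) (mul : {bilinear E -> E -> E}).
Variables (n : nat) (J : nat -> {vspace E}).

Hypothesis JnT : J n = {:E}%VS.
Hypothesis dimJ : forall m, (m <= n)%N -> \dim (J m) = m.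
Hypothesis sqJ : forall m, (m < n)%N -> mulsv mul (J m.+1) (J m.+1) = J m.

(** Both orders are recorded because [pairwise] only compares a vector with later ones and [mul] is
    not assumed commutative. *)
Let orth x y := (mul x y == 0) && (mul y x == 0).

(** If the term below is spanned by [B], one new basis vector gives a block of size one. Otherwise
    the term two steps below is, by [spanned_derived], and [admissible_block_exists] supplies a
    block of size two. Orthogonality is carried along because rescaled vectors need not belong to
    [B]. *)
Lemma derived_blocks B m : evolution_basis mul B ->
    (forall k, (k <= n)%N -> ideal mul (J k)) ->
    (m <= n)%N -> spanned_by B (J m) ->
  exists bs, [/\ admissible_blocks mul bs, <<flatten bs>>%VS = J m,
                 size (flatten bs) = m & pairwise orth (flatten bs)].
Proof.
move=> evoB idJ; elim/ltn_ind: m => -[_ _ _|m IHm ltmn spJ1].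
  by exists [::]; split=> //=; apply/eqP; rewrite span_nil eq_sym -dimv_eq0 dimJ.
have sJ k := derived_step JnT sqJ (m := k).
have [spJ | nspJ] := boolP (spanned_by B (J m)).
  have [bs [adm defJ szm orthJ]] := IHm m (ltnSn m) (ltnW ltmn) spJ.
  have [x [Bx Jx nJx]] : exists x, [/\ x \in B, x \in J m.+1 & x \notin J m].
    apply: spanned_by_fresh spJ1 _; apply/negP => /dimvS.
    by rewrite !dimJ ?ltnn // ltnW.
  exists (rcons bs [:: x]); split.
  - apply/admissible_blocks_rcons; split=> //.
    by apply/admissible_block1; rewrite defJ -sqJ // mem_mulsv.
  - rewrite flatten_rcons span_cat span_seq1 defJ.
    by apply: add_line_eq => //; [apply: sJ | rewrite !dimJ // ltnW].
  - by rewrite flatten_rcons size_cat szm addn1.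
  - rewrite flatten_rcons pairwise_cat orthJ /= andbT.
    apply/allrelP => u y /memv_span; rewrite defJ inE => Ju /eqP ->.
    by rewrite /orth; have [-> ->] := mul_fresh evoB spJ Bx nJx Ju; rewrite eqxx.
have m_gt0 : (0 < m)%N.
  rewrite lt0n; apply: contraNneq nspJ => m0; rewrite /spanned_by m0.
  by have /eqP-> : J 0%N == 0%VS; [rewrite -dimv_eq0 dimJ | apply: sub0v].
(* The index shifts by one: [J m.+2] is now the target, and [J m.+1] is the term not spanned by
   [B]. *)
case: m m_gt0 => // m _ in IHm ltmn spJ1 nspJ *.
have ltm := ltnW (ltnW ltmn).
have [spJ | /idPn] := spanned_derived JnT dimJ sqJ evoB (idJ m ltm) (ltnW ltmn);
  last by rewrite nspJ.
have [bs [adm defJ szm orthJ]] := IHm m (ltnW (ltnSn _)) ltm spJ.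
have [||||||||x [y [defV admxy xy0 yx0 orthxy]]] :=
  @admissible_block_exists _ _ mul B (J m) (J m.+1) (J m.+2) evoB (idJ _ ltm).
- by rewrite !sJ // ltnW.
- by rewrite !dimJ // ltnW.
- by rewrite !dimJ.
- exact: sqJ.
- by rewrite sqJ // ltnW.
- exact: spJ.
- exact/negP.
- exact: spJ1.
exists (rcons bs [:: x; y]); split.
- by apply/admissible_blocks_rcons; rewrite defJ.
- by rewrite flatten_rcons span_cat defJ.
- by rewrite flatten_rcons size_cat szm addn2.
rewrite flatten_rcons pairwise_cat orthJ /= /orth xy0 yx0 eqxx !andbT /=.
apply/allrelP => u z /memv_span; rewrite defJ !inE => Ju.
by have [ux xu uy yu] := orthxy u Ju; case/orP=> /eqP ->;
   rewrite ?ux ?xu ?uy ?yu eqxx.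
Qed.

(** Blocks yield an ideal of every dimension, which [ideal_derived] identifies with the derived term
    of that dimension. Conversely, [derived_blocks] is applied to the whole space. *)
Lemma supersolvable_blocks : evolution_algebra mul ->
  supersolvable mul <->
  exists bs, [/\ admissible_blocks mul bs, evolution_basis mul (flatten bs)
               & size (flatten bs) = n].
Proof.
case=> B /natural_basisP evoB.
apply: (iff_trans (supersolvable_derived JnT dimJ sqJ)).
split=> [idJ | [bs [adm evobs szn]] m lemn]; last first.
  rewrite -szn in lemn; rewrite -(cats0 (flatten bs)) in evobs.
  have [I idI <-] := admissible_blocks_ideal evobs adm lemn.
  by rewrite -(ideal_derived JnT dimJ sqJ idI).
have spJ : spanned_by B (J n).
  rewrite JnT /spanned_by -{1}(span_basis evoB.1) sub_span // => x Bx.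
  by rewrite mem_filter memvf.
have [bs [adm defJ szn orthJ]] := derived_blocks evoB idJ (leqnn n) spJ.
exists bs; split=> //; split.
  by rewrite basisEdim defJ JnT subvv szn -JnT dimJ /=.
move=> x y /(nthP 0)[i lti <-] /(nthP 0)[j ltj <-] neq.
have orth_lt := pairwiseP 0 orthJ.
have [ltij | ltji | eqij] := ltngtP i j; last by rewrite eqij eqxx in neq.
  by case/andP: (orth_lt i j lti ltj ltij) => /eqP.
by case/andP: (orth_lt j i ltj lti ltji) => _ /eqP.
Qed.

(** The rows are the coordinates of the squares of basis vectors, and these squares span the second
    derived term [J n.-1]. *)
Lemma rank_structure_matrix (B : n.-tuple E) : natural_basis mul B ->
  \rank (structure_matrix mul B) = n.-1.
Proof.
move=> /natural_basisP[basB B0].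
pose X := [tuple mul (tnth B i) (tnth B i) | i < n].
have -> : structure_matrix mul B = \matrix_(i, k) coord B k (tnth X i).
  by apply/matrixP => i k; rewrite !mxE tnth_mktuple.
have [n0 | n_gt0] := posnP n.
  by move: (\rank _) (rank_leq_row (\matrix_(i, k) coord B k (tnth X i))); lia.
rewrite rank_coord_mx // -[RHS]dimJ ?leq_pred //; congr (\dim _).
rewrite -sqJ ?prednK // JnT -(span_basis basB).
apply/eqP; rewrite eqEsubv; apply/andP; split.
  apply/span_subvP => _ /tnthP[i ->]; rewrite tnth_mktuple.
  by apply: mem_mulsv; apply/memv_span/mem_tnth.
apply/mulsv_subP; apply: mul_span => x y Bx By.
have [<- | neq] := eqVneq x y; last by rewrite B0 ?mem0v.
case/tnthP: Bx => i ->; apply: memv_span; apply/tnthP; exists i.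
by rewrite tnth_mktuple.
Qed.

End MaximalIndexBlocks.

(** * From lists of blocks to block matrices *)

Lemma mem_span_take (K : fieldType) (E : vectType K) n (B : n.-tuple E) m u :
    basis_of {:E}%VS B ->
  u \in <<take m B>>%VS <-> forall k : 'I_n, (m <= k)%N -> coord B k u = 0.
Proof.
move=> basB; split=> [Bu k lemk | coord0].
  rewrite (coord_span (X := in_tuple (take m B)) Bu) linear_sum big1 // => i _.
  have lti : (i < m)%N.
    by apply: leq_trans (ltn_ord i) _; rewrite size_take_min geq_minl.
  have ltin : (i < n)%N := ltn_trans (leq_trans lti lemk) (ltn_ord k).
  rewrite linearZ /= nth_take //.
  rewrite (coord_free (Ordinal ltin)) ?(basis_free basB) //.
  by rewrite -val_eqE /= ltn_eqF ?mulr0 // (leq_trans lti).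
rewrite (coord_basis basB (memvf u)); apply: rpred_sum => k _.
have [/coord0 -> | ltkm] := leqP m k; first by rewrite scale0r mem0v.
apply/rpredZ/memv_span; rewrite -(nth_take _ ltkm) mem_nth //.
by rewrite size_take_min size_tuple leq_min ltkm ltn_ord.
Qed.

Section BlockMatrix.

Variables (K : fieldType) (E : vectType K) (mul : {bilinear E -> E -> E}).
Variables (n : nat) (B : n.-tuple E) (bs : seq (seq E)).
Variables (r : nat) (p : 'I_r -> nat) (np : n = (\sum_(i < r) p i)%N).

Hypothesis basB : basis_of {:E}%VS B.
Hypothesis defB : flatten bs = B.
Hypothesis szbs : size bs = r.
Hypothesis defp : forall i : 'I_r, p i = size (nth [::] bs i).

(** The index in [B] of the vector number [a] of block [i]; [tagnat.Rank] is the numbering on which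
    [submxblock] relies. *)
Let pos (i : 'I_r) (a : 'I_(p i)) : 'I_n := cast_ord (esym np) (tagnat.Rank i a).

Lemma flatten_nth i : (i < r)%N ->
  flatten bs = flatten (take i bs) ++ nth [::] bs i ++ flatten (drop i.+1 bs).
Proof.
move=> lti; rewrite -{1}(cat_take_drop i bs) flatten_cat.
by rewrite (drop_nth [::]) ?szbs.
Qed.

Lemma leq_size_flatten_take i j : (i <= j)%N ->
  (size (flatten (take i bs)) <= size (flatten (take j bs)))%N.
Proof.
move=> leij; rewrite -(take_takel bs leij).
by rewrite -{2}(cat_take_drop i (take j bs)) flatten_cat size_cat leq_addr.
Qed.

Lemma block_posE i a : @pos i a = (size (flatten (take i bs)) + a)%N :> nat.
Proof.
rewrite [LHS](tagnat.RankEsum a); congr (_ + _)%N.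
rewrite size_flatten sumnE big_map (big_nth [::]) size_takel ?szbs; last first.
  exact: ltnW.
rewrite (eq_bigr (fun k : 'I_r => size (nth [::] bs k))) //.
rewrite -(big_mkord (fun k => k < i)%N (fun k => size (nth [::] bs k))).
transitivity (\sum_(0 <= k < i) size (nth [::] bs k))%N.
  by rewrite [RHS](big_nat_widen _ _ r) // ltnW.
by apply: eq_big_nat => k /andP[_ ltk]; rewrite nth_take.
Qed.

Lemma nth_block i (a : 'I_(p i)) : (nth [::] bs i)`_a = B`_(pos a).
Proof.
rewrite block_posE -defB (flatten_nth (ltn_ord i)) nth_cat ltnNge leq_addr /=.
by rewrite addKn nth_cat -defp ltn_ord.
Qed.

Lemma block_pos_surj k : exists i (a : 'I_(p i)), k = pos a.
Proof.
exists (tagnat.sig1 (cast_ord np k)), (tagnat.sig2 (cast_ord np k)).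
by rewrite /pos tagnat.sig2K cast_ordK.
Qed.

Lemma coord_block_sum (i j : 'I_r) (b : 'I_(p j)) :
  coord B (pos b) (\sum_(y <- nth [::] bs i) y) = (i == j)%:R.
Proof.
rewrite (big_nth 0) -defp big_mkord linear_sum /=.
under eq_bigr => a _ do rewrite nth_block coord_free ?(basis_free basB) //
  -val_eqE /= tagnat.eq_Rank.
have [-> | neq] := eqVneq i j; last by rewrite big1.
by rewrite (bigD1 b) //= eqxx big1 ?addr0 // => a /negPf; rewrite -val_eqE /= => ->.
Qed.

(** Lying in the span of the blocks before [i] means having zero coordinates from block [i] on, and
    there the sum over block [i] has coordinate 1 inside the block and 0 beyond it. *)
Lemma square_blockP i (a : 'I_(p i)) c :
  mul (nth [::] bs i)`_a (nth [::] bs i)`_a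
      - c *: (\sum_(y <- nth [::] bs i) y) \in <<flatten (take i bs)>>%VS <->
  (forall j (b : 'I_(p j)), (i <= j)%N ->
     structure_matrix mul B (pos a) (pos b) = c *+ (i == j)).
Proof.
have -> : flatten (take i bs) = take (size (flatten (take i bs))) B.
  by rewrite -defB (flatten_nth (ltn_ord i)) take_size_cat.
rewrite (mem_span_take _ _ basB).
have E0 j (b : 'I_(p j)) : coord B (pos b)
      (mul (nth [::] bs i)`_a (nth [::] bs i)`_a - c *: (\sum_(y <- nth [::] bs i) y)) =
    structure_matrix mul B (pos a) (pos b) - c *+ (i == j).
  by rewrite linearB linearZ /= coord_block_sum mulr_natr mxE nth_block (tnth_nth 0).
split=> [M0 j b leij | M0 k lek].
  apply/eqP; rewrite -subr_eq0 -E0; apply/eqP/M0; rewrite block_posE.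
  by apply: leq_trans (leq_addr _ _); apply: leq_size_flatten_take.
have [j [b defk]] := block_pos_surj k; rewrite defk E0 M0 ?subrr //.
rewrite leqNgt; apply/negP => ltji; move: lek; rewrite defk block_posE.
apply/negP; rewrite -ltnNge; apply: leq_trans (leq_size_flatten_take ltji).
by rewrite (take_nth [::]) ?szbs // flatten_rcons size_cat -defp -addnS leq_add2l.
Qed.

Let A' : 'M[K]_(\sum_(i < r) p i) := castmx (np, np) (structure_matrix mul B).

(** Both admissible diagonal blocks have constant rows, so a single statement serves them, with
    [c a] equal to 0 or to [(-1) ^+ a]. *)
Lemma block_rowP i (c : nat -> K) :
  (forall a, (a < p i)%N -> mul (nth [::] bs i)`_a (nth [::] bs i)`_a
      - c a *: (\sum_(y <- nth [::] bs i) y) \in <<flatten (take i bs)>>%VS) <->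
  (forall j : 'I_r, (i < j)%N -> submxblock A' i j = 0) /\
  (forall a b, submxblock A' i i a b = c a).
Proof.
have A'E j (a : 'I_(p i)) (b : 'I_(p j)) :
    submxblock A' i j a b = structure_matrix mul B (pos a) (pos b).
  by rewrite [LHS]mxE castmxE.
split=> [sq | [low diag] a lta].
  split=> [j ltij | a b].
    apply/matrixP => a b; rewrite A'E [RHS]mxE.
    rewrite (square_blockP a (c a)).1 ?(ltnW ltij) //.
      by rewrite -val_eqE /= ltn_eqF.
    exact: sq.
  by rewrite A'E (square_blockP a (c a)).1 ?eqxx //; apply: sq.
apply/(square_blockP (Ordinal lta)) => j b.
rewrite leq_eqVlt => /predU1P[/val_inj eqij | ltij].
  by case: _ / eqij in b *; rewrite -A'E diag eqxx.
by rewrite -A'E low // mxE -val_eqE /= ltn_eqF.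
Qed.

Lemma admissible_matrix_blocks :
  (forall i j : 'I_r, (i < j)%N -> submxblock A' i j = 0) /\
  (forall i : 'I_r, admissible_diag_block (submxblock A' i i)) <->
  admissible_blocks mul bs.
Proof.
split=> [[low diag] i | adm].
  rewrite szbs => lti; pose i' := Ordinal lti.
  rewrite /admissible_block -[size _](defp i').
  have [[p1 D0] | [p2 D1]] := diag i'.
    left; split=> //; have := (block_rowP i' (fun=> 0)).2.
    move=> /(_ _ 0%N); rewrite scale0r subr0; apply; last by rewrite p1.
    by split=> [|a b]; [apply: low | rewrite D0 mxE].
  right; split=> // a; rewrite -p2; move: a; apply: (block_rowP i' _).2.
  by split=> [|a b]; [apply: low | rewrite D1 mxE].
have row (i : 'I_r) : (forall j : 'I_r, (i < j)%N -> submxblock A' i j = 0) /\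
             admissible_diag_block (submxblock A' i i).
  have := adm i; rewrite szbs ltn_ord /admissible_block -[size _](defp i).
  case/(_ isT) => [] [szp sq].
    have [|low D0] := (block_rowP i (fun=> 0)).1.
      by move=> a; rewrite szp scale0r subr0; case: a.
    by split=> //; left; split=> //; apply/matrixP => a b; rewrite D0 mxE.
  have [|low D1] := (block_rowP i (fun a => (-1) ^+ a)).1.
    by move=> a; rewrite szp; apply: sq.
  by split=> //; right; split=> //; apply/matrixP => a b; rewrite D1 mxE.
by split=> i; have [] := row i.
Qed.

End BlockMatrix.

Lemma admissible_structure_matrixP (K : fieldType) (E : vectType K)
    (mul : {bilinear E -> E -> E}) n (B : n.-tuple E) :
    basis_of {:E}%VS B ->
  admissible_block_lower_triangular (structure_matrix mul B) <->
  exists2 bs, flatten bs = B & admissible_blocks mul bs.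
Proof.
move=> basB; split=> [[r [p [np adm]]] | [bs defB adm]].
  have szB : size B = sumn (codom p).
    by rewrite size_tuple {1}np sumnE big_map big_enum.
  (* The block sizes of the matrix dictate where the list [B] is cut. *)
  exists (reshape (codom p) B); first by rewrite reshapeKr ?szB.
  apply/(admissible_matrix_blocks mul np basB) => //.
  - by rewrite reshapeKr ?szB.
  - by rewrite size_reshape size_codom card_ord.
  - move=> i; have := congr1 (nth 0%N ^~ i) (@reshapeKl _ (codom p) B _).
    rewrite /shape (nth_map [::]) ?size_reshape ?size_codom ?card_ord //.
    by rewrite codomE (nth_map i) ?size_enum_ord // nth_ord_enum szB => ->.
have np : n = (\sum_(i < size bs) size (nth [::] bs i))%N.
  rewrite -{1}(size_tuple B) -defB size_flatten sumnE big_map (big_nth [::]).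
  by rewrite big_mkord.
exists (size bs), (fun i : 'I_(size bs) => size (nth [::] bs i)), np.
by apply/(admissible_matrix_blocks mul np basB defB).
Qed.

Theorem theorem6p10 (K : fieldType) (E : vectType K)
    (mul : {bilinear E -> E -> E}) (n : nat)
    (charK : 2%N \notin [pchar K])
    (evoE : evolution_algebra mul)
    (dimE : \dim {:E} = n)
    (solE : solvable_algebra mul)
    (maxE : has_solvability_index mul n.+1) :
  (supersolvable mul <->
   exists B : n.-tuple E,
     [/\ natural_basis mul B,
         admissible_block_lower_triangular (structure_matrix mul B)
       & \rank (structure_matrix mul B) = n.-1]) /\
  (supersolvable mul <->
   ~ exists k : nat,
       [/\ (1 <= k <= n)%N,
           ~ basic_ideal mul (derived_term mul k)
         & ~ basic_ideal mul (derived_term mul k.+1)]).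
Proof.
pose J m := derived_term mul (n.+1 - m).
have JnT : J n = {:E}%VS by rewrite /J subSn // subnn.
have dimJ m : (m <= n)%N -> \dim (J m) = m by apply: dim_derived_term.
have sqJ m : (m < n)%N -> mulsv mul (J m.+1) (J m.+1) = J m.
  move=> ltmn; rewrite /J subSS -derived_termS ?subn_gt0 //.
  by rewrite subSn // ltnW.
split.
  apply: (iff_trans (supersolvable_blocks JnT dimJ sqJ evoE)).
  split=> [[bs [adm evobs /eqP szn]] | [B [natB admB _]]].
    pose B := Tuple szn; have natB : natural_basis mul B by apply/natural_basisP.
    exists B; split=> //; last exact: (rank_structure_matrix JnT dimJ sqJ).
    by apply/(admissible_structure_matrixP mul natB.1); exists bs.
  have [bs defB adm] := (admissible_structure_matrixP mul natB.1).1 admB.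
  exists bs; rewrite defB size_tuple; split=> //.
  exact/natural_basisP.
apply: (iff_trans (supersolvable_basic JnT dimJ sqJ evoE)).
split=> [basJ [k [/andP[k_gt0 lekn] nb nb1]] | nbasD m ltmn [nb1 nb]].
  (* The derived terms number [k] and [k.+1] are [J (n - k).+1] and [J (n - k)]. *)
  have ltkn : (n - k < n)%N by lia.
  apply: (basJ (n - k)%N ltkn).
  by rewrite /J subSS subSn ?leq_subr // subKn.
by apply: nbasD; exists (n - m)%N; rewrite subn_gt0 ltmn leq_subr -subSn 1?ltnW.
Qed.
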